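(* Let $G$ be a cycle. Then there are no evasive walks on $G$.
   Context: A walk on $G$ is an infinite sequence $R(1),R(2),\ldots$ of vertices with $R(i)$ adjacent to $R(i+1)$ for all $i$. A random walk on $G$: $R(1)$ uniform among vertices, each $R(i+1)$ uniform among neighbours of $R(i)$. For walks $R,S$, tokens $T_R,T_S$ start at $R(1),S(1)$; a move advances exactly one token one step along its own walk. The pair $(R,S)$ is successful if there is an infinite sequence of moves in which each token is advanced infinitely often and the tokens never occupy the same vertex simultaneously (including initially). A walk $S$ is evasive if for a random walk $R$ on $G$, $(R,S)$ is successful with positive probability. *)

(* Defs.v *)
From HB Require Import structures.
From mathcomp Require Import all_boot all_order all_algebra.
From mathcomp Require Import all_classical all_reals all_analysis.

Set Implicit Arguments.
Unset Strict Implicit.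
Unset Printing Implicit Defensive.

Import Order.TTheory GRing.Theory Num.Theory.

Local Open Scope classical_set_scope.
Local Open Scope ring_scope.

(* A graph is an adjacency relation [e : rel V] on a finite vertex type; time
   starts at 0, so the walk R(1), R(2), ... is [r 0, r 1, ...]. *)

(* [s] lists all the vertices in cyclic order; [3 <= size s] excludes loops
   and double edges. Symmetry and irreflexivity of [e] follow. *)
Definition is_cycle (V : finType) (e : rel V) : Prop :=
  exists s : seq V,
    [/\ (3 <= size s)%N, uniq s, (forall v, v \in s)
      & forall x y, e x y = (y == next s x) || (x == next s y)].

Definition walk (V : finType) (e : rel V) (s : nat -> V) : Prop :=
  forall i, e (s i) (s i.+1).

Definition degree (V : finType) (e : rel V) (x : V) : nat :=
  #|[pred y | e x y]|.

Definition transition (R : realType) (V : finType) (e : rel V) (x y : V) : R :=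
  if e x y then (degree e x)%:R^-1 else 0.

(* The event X_0 = h 0, ..., X_k = h k. *)
Definition history (Omega : Type) (V : finType) (X : nat -> Omega -> V)
    (h : nat -> V) (k : nat) : set Omega :=
  [set w | forall i, (i <= k)%N -> X i w = h i].

(* The third clause is P(X_(k+1) = h (k+1) | history) = transition, multiplied
   out so that histories of probability zero are covered. *)
Definition random_walk (R : realType) (V : finType) (e : rel V)
    (d : measure_display) (Omega : measurableType d) (P : probability Omega R)
    (X : nat -> Omega -> V) : Prop :=
  [/\ forall i v, measurable [set w | X i w = v],
      forall v, P [set w | X 0%N w = v] = (#|V|%:R^-1)%:E
    & forall (h : nat -> V) (k : nat),
        P (history X h k.+1) =
          (P (history X h k) * (transition R e (h k) (h k.+1))%:E)%E].

(* A sequence of moves is [m : nat -> bool]: move number t advances the token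
   of the first walk if [m t], and that of the second walk otherwise. *)
Definition advances (m : nat -> bool) (t : nat) : nat := (\sum_(i < t) m i)%N.

Definition successful (V : finType) (r s : nat -> V) : Prop :=
  exists m : nat -> bool,
    [/\ forall t, exists2 u, (t <= u)%N & m u,
        forall t, exists2 u, (t <= u)%N & ~~ m u
      & forall t, r (advances m t) <> s (advances (fun i => ~~ m i) t)].

(* The success event is a projection of a Borel set, hence universally
   measurable, but not evidently in the sigma-algebra of [Omega]. Its
   probability is taken with the outer measure [mu_ext P], which agrees with
   [P] on measurable sets and with the completion of [P] in general; it depends
   only on the law of [X], so the choice of probability space is immaterial. *)
Definition evasive (R : realType) (V : finType) (e : rel V) (s : nat -> V) :
    Prop :=
  walk e s /\
  exists (d : measure_display) (Omega : measurableType d)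
         (P : probability Omega R) (X : nat -> Omega -> V),
    random_walk e P X /\
    (0 < mu_ext P [set w | successful (fun i => X i w) s])%E.

(* Main.v *)
(** Lift both walks from the cycle of length n to the integers. The tokens
    avoid each other exactly when the difference of their lifts avoids the
    multiples of n, so during a successful schedule the lifts stay at distance
    less than n. If the lift of the fixed walk S is bounded, then so is that of
    R, which has probability zero. Otherwise, for each level A_c = 2^c * 2n, let
    eps_c be the side on which S first leaves (-A_c, A_c). The lift of R is
    forced to reach eps_c (A_c - n) before -eps_c (A_c + n), for every c. As the
    levels grow geometrically, each of these demands fails with probability
    bounded below given the previous ones. Both estimates are instances of the
    maximal inequality for a nonnegative supermartingale that is unbounded on
    success: (M+1)^2 - z^2 + k killed on leaving [-M, M] in the first case, and the
    gambler's ruin function, multiplied by 8/7 at each level, in the second. *)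

Require Import Defs.
From mathcomp Require Import all_boot all_order all_algebra.
From mathcomp Require Import all_classical all_reals all_analysis.
From mathcomp Require Import ring lra zify.

Set Implicit Arguments.
Unset Strict Implicit.
Unset Printing Implicit Defensive.

Import Order.TTheory GRing.Theory Num.Theory.

Local Open Scope classical_set_scope.
Local Open Scope ring_scope.

(** * Measurability of events depending on finitely many coordinates *)

Definition update (V : Type) (h : nat -> V) (k : nat) (v : V) : nat -> V :=
  fun i => if i == k then v else h i.

Lemma update_id (V : Type) (h : nat -> V) (k : nat) : update h k (h k) = h.
Proof. by apply/funext => i; rewrite /update; case: eqP => // ->. Qed.

(** Splitting on the value of the last coordinate leaves a finite union of events that depend on one
    coordinate fewer. With no coordinates left, the event is empty or everything. *)
Lemma measurable_cylinder (V : finType) (d : measure_display)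
    (Omega : measurableType d) (X : nat -> Omega -> V)
    (mX : forall i v, measurable [set w | X i w = v]) (k : nat) :
  forall Q : (nat -> V) -> Prop,
  (forall h h', (forall i, (i < k)%N -> h i = h' i) -> Q h -> Q h') ->
  measurable [set w | Q (X^~ w)].
Proof.
elim: k => [|k IH] Q Qk.
  have [[w Qw]|nQ] := pselect (exists w, Q (X^~ w)).
    rewrite (_ : [set _ | _] = setT); first exact: measurableT.
    by apply/seteqP; split => // w' _ /=; exact: Qk Qw.
  rewrite (_ : [set _ | _] = set0); first exact: measurable0.
  by apply/seteqP; split => // w' /= Qw'; apply: nQ; exists w'.
rewrite (_ : [set _ | _] = \bigcup_(v in [set: V])
    ([set w | X k w = v] `&` [set w | Q (update (X^~ w) k v)])); last first.
  apply/seteqP; split => [w Qw|w [v _] [/= <-]]; last by rewrite update_id.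
  by exists (X k w) => //; split => //=; rewrite update_id.
apply: fin_bigcup_measurable => // v _; apply: measurableI; first exact: mX.
apply: (IH (fun h => Q (update h k v))) => h h' hh'.
apply: Qk => i; rewrite ltnS /update; case: eqP => // /eqP nik ik.
by apply: hh'; rewrite ltn_neqAle nik.
Qed.

Lemma measure_le_sum (R : realType) (V : finType)
    (d : measure_display) (Omega : measurableType d) (P : probability Omega R)
    (A : set Omega) (F : V -> set Omega) :
  measurable A -> (forall v, measurable (F v)) ->
  (forall w, A w -> exists v, F v w) -> (P A <= \sum_v P (F v))%E.
Proof.
move=> mA mF AF.
pose U (r : seq V) := \big[setU/set0]_(v <- r) F v.
have mU r : measurable (U r) by exact: bigsetU_measurable.
apply: (@le_trans _ _ (P (U (index_enum V)))).
  apply: le_measure; rewrite ?inE // => w /AF[v Fv].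
  by rewrite /U -bigcup_seq; exists v => //=; rewrite mem_index_enum.
elim: (index_enum V) => [|v r IH]; first by rewrite /U !big_nil measure0.
rewrite /U !big_cons.
apply: le_trans (leeD2l _ IH); apply: measureU2 => //; exact: mU.
Qed.

(** * Supermartingales along the random walk and their maximal inequality *)

(** A nonnegative adapted supermartingale, written as a function of time and path. The averaging
    inequality is asked only after histories that follow edges, since a lifted path describes the
    vertices only for those. *)
Definition superharmonic (R : realType) (V : finType) (e : rel V)
    (W : nat -> (nat -> V) -> R) : Prop :=
  [/\ forall k h, 0 <= W k h,
      forall k h h', (forall i, (i <= k)%N -> h i = h' i) -> W k h = W k h'
    & forall k h, (forall i, (i < k)%N -> e (h i) (h i.+1)) ->
        \sum_v transition R e (h k) v * W k.+1 (update h k.+1 v) <= W k h].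

Section maximal_inequality.
Context (R : realType) (V : finType) (e : rel V).
Context (d : measure_display) (Omega : measurableType d).
Context (P : probability Omega R) (X : nat -> Omega -> V).
Hypothesis X_walk : random_walk e P X.

Let mX : forall i v, measurable [set w | X i w = v].
Proof. by case: X_walk. Qed.

Let mhistory h k : measurable (history X h k).
Proof.
apply: (measurable_cylinder mX (k := k.+1)
  (Q := fun h' => forall i, (i <= k)%N -> h' i = h i)) => h1 h2 h12 Q i ik.
by rewrite -h12 // Q.
Qed.

Lemma history_step h k v :
  P (history X (update h k.+1 v) k.+1) =
  (P (history X h k) * (transition R e (h k) v)%:E)%E.
Proof.
have [_ _ ->] := X_walk.
rewrite /update eqxx ltn_eqF //; congr (P _ * _)%E.
by apply/seteqP; split => w /= H i ik; have := H i ik; rewrite ltn_eqF.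
Qed.

Lemma history_nonwalk h k :
  ~ (forall i, (i < k)%N -> e (h i) (h i.+1)) -> P (history X h k) = 0%E.
Proof.
elim: k => [|k IH] H; first by case: H.
have [_ _ ->] := X_walk.
have [/IH ->|Hk] := pselect (~ forall i, (i < k)%N -> e (h i) (h i.+1)).
  by rewrite mul0e.
rewrite /transition ifF ?mule0 //; apply/negP => ehk; apply: H => i.
rewrite ltnS leq_eqVlt => /predU1P[-> //|ik].
by apply: (contrapT Hk).
Qed.

Variables (W : nat -> (nat -> V) -> R) (lam : R).
Hypotheses (W_super : superharmonic e W) (lam_gt0 : 0 < lam).

Let reach k T := [set w | exists2 j, (k <= j <= k + T)%N & lam <= W j (X^~ w)].

Let mreach k T : measurable (reach k T).
Proof.
apply: (measurable_cylinder mX (k := (k + T).+1)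
  (Q := fun h => exists2 j, (k <= j <= k + T)%N & lam <= W j h)).
move=> h h' hh' [j /andP[kj jT] Wj]; exists j; first by rewrite kj.
have [_ Wad _] := W_super; rewrite -(Wad j h) // => i ij.
by apply: hh'; rewrite ltnS (leq_trans ij).
Qed.

(** Conditioning on the first step replaces a stopping-time argument: if [W] is still below [lam],
    the target must be reached from time [k.+1] on, so the induction hypothesis applies to each
    one-step extension and superharmonicity sums the bounds. *)
Lemma maximal_inequality_history T k h :
  (P (history X h k `&` reach k T) <= P (history X h k) * (W k h / lam)%:E)%E.
Proof.
have [W0 Wad Wsup] := W_super.
have mH h' k' T' : measurable (history X h' k' `&` reach k' T').
  by apply: measurableI; [exact: mhistory|exact: mreach].
have easy T' k' h' : lam <= W k' h' ->
    (P (history X h' k' `&` reach k' T') <=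
     P (history X h' k') * (W k' h' / lam)%:E)%E.
  move=> Wlam; apply: (@le_trans _ _ (P (history X h' k'))).
    by apply: le_measure; rewrite ?inE //=; exact: mhistory.
  by apply: lee_pemulr => //; rewrite lee_fin ler_pdivlMr // mul1r.
elim: T k h => [|T IH] k h; have [/easy //|Wlt] := leP lam (W k h).
  rewrite (_ : _ `&` _ = set0) ?measure0.
    by apply: mule_ge0 => //; rewrite lee_fin divr_ge0 // ltW.
  apply/seteqP; split => // w [/= Hw [j]]; rewrite addn0 -eqn_leq => /eqP <-.
  by rewrite (Wad _ _ h) // leNgt Wlt.
(* Histories that break an edge have probability zero; only for the others is the averaging
   inequality available. *)
have [walkh|/history_nonwalk P0] :=
    pselect (forall i, (i < k)%N -> e (h i) (h i.+1)); last first.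
  rewrite P0 mul0e -P0; apply: le_measure; rewrite ?inE //=; exact: mhistory.
pose hv v := update h k.+1 v.
apply: (@le_trans _ _
    (\sum_v P (history X (hv v) k.+1 `&` reach k.+1 T))%E).
  apply: measure_le_sum => // w [Hw [j /andP[kj jT] Wj]].
  exists (X k.+1 w); split.
    move=> i; rewrite leq_eqVlt ltnS /hv /update => /predU1P[->|ik].
      by rewrite eqxx.
    by rewrite ltn_eqF //; exact: Hw.
  exists j => //; rewrite addSnnS jT andbT ltn_neqAle kj andbT.
  by apply/eqP => jk; move: Wj; rewrite -jk (Wad _ _ h) // leNgt Wlt.
apply: (@le_trans _ _
    (\sum_v (P (history X h k) * (transition R e (h k) v * W k.+1 (hv v) / lam)%:E))%E).
  apply: lee_sum => v _; apply: le_trans (IH _ _) _.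
  by rewrite history_step -muleA -EFinM mulrA.
rewrite -ge0_sume_distrr; last first.
  move=> v _; rewrite lee_fin divr_ge0 ?(ltW lam_gt0) // mulr_ge0 //.
  by rewrite /transition; case: ifP => // _; rewrite invr_ge0.
apply: lee_wpmul2l => //; rewrite sumEFin lee_fin -mulr_suml.
by rewrite ler_pM2r ?invr_gt0 //; exact: Wsup.
Qed.

(** The finite-horizon bounds pass to the limit by continuity from below. The factor [#|V|] comes
    from bounding the probability of each starting vertex by 1, which is harmless because [lam] will
    tend to infinity. *)
Lemma maximal_inequality (C : R) : (forall h, W 0%N h <= C) ->
  (P [set w | (exists j, lam <= W j (X^~ w))%R] <= (#|V|%:R * (C / lam))%:E)%E.
Proof.
move=> WC; have [W0 _ _] := W_super.
have -> : [set w | exists j, lam <= W j (X^~ w)] = \bigcup_T reach 0 T.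
  apply/seteqP; split => [w [j Wj]|w [T _ [j _ Wj]]]; last by exists j.
  by exists j => //; exists j => //; rewrite leqnn.
have ndreach : nondecreasing_seq (reach 0).
  move=> S T ST; apply/subsetPset => w [j /andP[j0 jS] Wj].
  by exists j => //; rewrite (leq_trans jS).
have cvgreach := nondecreasing_cvg_mu (mu := P) (mreach 0)
  (bigcupT_measurable _ (mreach 0)) ndreach.
rewrite -(cvg_lim _ cvgreach) //; apply: lime_le; first exact: cvgP cvgreach.
apply: nearW => T /=.
apply: (@le_trans _ _
    (\sum_v P (history X (fun=> v) 0 `&` reach 0 T))%E).
  apply: measure_le_sum => // [v|w wT].
    by apply: measurableI => //; exact: mreach.
  by exists (X 0%N w); split => // i; rewrite leqn0 => /eqP ->.
apply: (@le_trans _ _ (\sum_(v : V) (C / lam)%:E)%E); last first.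
  by rewrite sumEFin lee_fin sumr_const mulr_natl.
apply: lee_sum => v _; apply: le_trans (maximal_inequality_history _ _ _) _.
apply: (@le_trans _ _ (W 0%N (fun=> v) / lam)%:E).
  rewrite -[leRHS]mul1e; apply: lee_wpmul2r; last exact: probability_le1.
  by rewrite lee_fin divr_ge0 // ltW.
by rewrite lee_fin ler_pM2r ?invr_gt0.
Qed.

End maximal_inequality.

(** The set [A] need not be measurable: for each [lam] it is covered by the measurable event that
    level [lam] is reached, whose probability is of order [1 / lam]. *)
Lemma null_of_unbounded (R : realType) (V : finType) (e : rel V)
    (d : measure_display) (Omega : measurableType d) (P : probability Omega R)
    (X : nat -> Omega -> V) (W : nat -> (nat -> V) -> R) (C : R)
    (A : set Omega) :
  random_walk e P X -> superharmonic e W -> (forall h, W 0%N h <= C) ->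
  (forall w, A w -> walk e (X^~ w) ->
     forall lam, exists k, lam <= W k (X^~ w)) ->
  (mu_ext P A <= 0)%E.
Proof.
move=> X_walk [W0 Wad Wsup] WC unbounded.
pose walk_upto k (h : nat -> V) := [forall i : 'I_k, e (h i) (h i.+1)].
(* Nonwalks carry no mass, so they may be sent to the target level at once. *)
pose W' lam k h := if walk_upto k h then W k h else lam.
have W'sup lam : 0 < lam -> superharmonic e (W' lam).
  move=> lam0; split.
  - by move=> k h; rewrite /W'; case: ifP => // _; exact: ltW.
  - move=> k h h' hh'; rewrite /W' (Wad k h h') //.
    suff -> : walk_upto k h = walk_upto k h' by [].
    by apply: eq_forallb => i; rewrite !hh' // ltnW.
  - move=> k h hk; rewrite /W' ifT; last by apply/forallP => i; exact: hk.
    apply: le_trans _ (Wsup k h hk); rewrite le_eqVlt; apply/orP; left.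
    apply/eqP/eq_bigr => v _; rewrite /transition.
    case: ifP => [ev|]; last by rewrite !mul0r.
    rewrite ifT //; apply/forallP => -[i /=]; rewrite ltnS leq_eqVlt /update.
    case/predU1P => [->|ik]; first by rewrite eqxx ltn_eqF.
    by rewrite !ltn_eqF //; [exact: hk|exact: ltnW].
have bound lam : 0 < lam -> (mu_ext P A <= (#|V|%:R * (C / lam))%:E)%E.
  move=> lam0.
  have mE : measurable [set w | exists j, lam <= W' lam j (X^~ w)].
    have mX : forall i v, measurable [set w | X i w = v] by case: X_walk.
    have -> : [set w | exists j, lam <= W' lam j (X^~ w)] =
        \bigcup_j [set w | lam <= W' lam j (X^~ w)].
      by apply/seteqP; split => [w [j]|w [j _]]; exists j.
    apply: bigcupT_measurable => j.
    apply: (measurable_cylinder mX (k := j.+1)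
      (Q := fun h => lam <= W' lam j h)) => h h' hh'.
    by have [_ W'ad _] := W'sup _ lam0; rewrite (W'ad j h h').
  apply: le_trans _ (maximal_inequality X_walk (W'sup _ lam0) lam0 _); last first.
    by move=> h; rewrite /W' ifT //; apply/forallP => -[].
  rewrite -(measurable_mu_extE P mE); apply: le_mu_ext => w Aw /=.
  have [ww|nw] := pselect (walk e (X^~ w)).
    have [k Wk] := unbounded w Aw ww lam.
    by exists k; rewrite /W'; case: ifP.
  have [i ni] : exists i, ~~ e (X i w) (X i.+1 w).
    by apply: contrapT => ne; apply: nw => i; apply: contrapT => /negP; eauto.
  exists i.+1; rewrite /W' ifF //; apply/negbTE/forallPn.
  by exists ord_max.
apply/lee_addgt0Pr => eps eps0; rewrite add0e.
(* The level used is [c / eps]; the added 1 keeps it positive even if [C] is 0. *)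
pose c := (#|V|%:R : R) * `|C| + 1.
have c0 : 0 < c by rewrite ltr_wpDl // mulr_ge0.
apply: le_trans (bound (c / eps) _) _; first exact: divr_gt0.
rewrite lee_fin invf_div [eps / c]mulrC !mulrA ger_pMl // ler_pdivrMr // mul1r.
apply: (@le_trans _ _ (#|V|%:R * `|C|)); last by rewrite /c lerDl.
by rewrite ler_wpM2l ?ler_norm.
Qed.

(** * Integer paths passing geometrically growing levels *)

Definition unit_steps (z : nat -> int) : Prop :=
  forall i, z i.+1 = z i + 1 \/ z i.+1 = z i - 1.

Section stages.
Variables (R : realType) (n : nat) (eps : nat -> int).
Hypotheses (n_gt0 : (0 < n)%N) (eps1 : forall c, eps c = 1 \/ eps c = -1).

Definition level (c : nat) : int := (2 ^ c * (2 * n))%N.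

Lemma levelS c : level c.+1 = 2 * level c.
Proof. by rewrite /level expnS -mulnA PoszM. Qed.

Lemma level_ge c : (2 * n)%:Z <= level c.
Proof. by rewrite /level lez_nat leq_pmull // expn_gt0. Qed.

(* The number of levels passed so far; [None] once the path has reached the
   wrong side of its current level. *)
Fixpoint stage (z : nat -> int) (k : nat) : option nat :=
  if k is k'.+1 then
    if stage z k' is Some c then
      if eps c * z k <= - (level c + n%:Z) then None
      else if level c - n%:Z <= eps c * z k then Some c.+1 else Some c
    else None
  else Some 0%N.

Lemma eq_stage z y k : (forall i, (i <= k)%N -> z i = y i) ->
  stage z k = stage y k.
Proof.
elim: k => //= k IH zy; rewrite IH; last by move=> i ik; exact: zy (leqW ik).
by rewrite zy.
Qed.

Section stage_of_path.
Variable z : nat -> int.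
Hypotheses (z_unit : unit_steps z) (z0 : `|z 0%N| < n%:Z).

(** Every level is at least [2 * n], so [level c + n <= 2 * level c - n]. The whole window of one
    stage thus lies inside the next one, whichever side the next stage favours, and the past of the
    path stays within bounds after an advance. *)
Lemma stage_bounds k c : stage z k = Some c ->
  forall i, (i <= k)%N ->
    - (level c + n%:Z) < eps c * z i < level c - n%:Z.
Proof.
elim: k c => [c [<-] i|k IH c /=].
  rewrite leqn0 => /eqP ->; have := level_ge 0; rewrite /level.
  by case: (eps1 0) => ->; lia.
case Ez: (stage z k) => [b|//]; have {}IH := IH b Ez.
have lb := level_ge b; have zk := IH k (leqnn k).
case: ifP => // dead; case: ifP => [up|up] [<-] i; rewrite leq_eqVlt ltnS.
  rewrite levelS => /predU1P[->|/IH].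
    by case: (eps1 b) (eps1 b.+1) up zk (z_unit k) => -> [] ->; lia.
  by case: (eps1 b) (eps1 b.+1) => -> [] ->; lia.
move=> /predU1P[->|/IH//].
by case: (eps1 b) up dead => ->; lia.
Qed.

Hypothesis z_hits : forall c, exists2 i, level c - n%:Z <= eps c * z i &
  forall j, (j <= i)%N -> - (level c + n%:Z) < eps c * z j.

(** Suppose the path dies at stage [c]. If its hit of the favoured side lies in the past,
    [stage_bounds] is violated; if it lies ahead, the wrong side cannot have been reached yet. *)
Lemma stage_alive k : stage z k <> None.
Proof.
elim: k => //= k IH; case Ez: (stage z k) IH => [c|//] _.
case: ifP => [dead|_]; last by case: ifP.
have [i hit before] := z_hits c.
have [ik|ki] := leqP i k; first by have := stage_bounds Ez ik; lia.
by have := before _ ki; lia.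
Qed.

Lemma stage_unbounded c : exists k b, (c <= b)%N /\ stage z k = Some b.
Proof.
have [i hit _] := z_hits c; exists i.
case Ez: (stage z i) => [b|]; last by have := @stage_alive i.
exists b; split => //; rewrite leqNgt; apply/negP => bc.
have := stage_bounds Ez (leqnn i).
have : level b.+1 <= level c by rewrite lez_nat leq_pmul2r ?leq_exp2l //; lia.
have := level_ge b; rewrite levelS.
by case: (eps1 b) (eps1 c) hit => -> [] ->; lia.
Qed.

End stage_of_path.

(* Shifted by 1 from the gambler's ruin probability, so that advancing a
   stage multiplies the affine factor by at most 7/8. *)
Definition ruin (c : nat) (x : int) : R :=
  (eps c * x + 3 * level c + n%:Z)%:~R / (2 * level c)%:~R.

Definition stage_potential (k : nat) (z : nat -> int) : R :=
  if stage z k is Some c then (8 / 7) ^+ c * ruin c (z k) else 0.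

Lemma level_gt0 c : 0 < (2 * level c)%:~R :> R.
Proof. by rewrite ltr0z; have := level_ge c; lia. Qed.

Lemma ruin_ge1 c x : - (level c + n%:Z) <= eps c * x -> 1 <= ruin c x.
Proof.
by move=> h; rewrite /ruin ler_pdivlMr ?level_gt0 // mul1r ler_int; lia.
Qed.

Lemma stage_potential_ge z k c : unit_steps z -> `|z 0%N| < n%:Z ->
  stage z k = Some c -> (8 / 7) ^+ c <= stage_potential k z.
Proof.
move=> zu z0 Ez; rewrite /stage_potential Ez ler_peMr ?exprn_ge0 //.
apply: ruin_ge1; have := stage_bounds zu z0 Ez (leqnn k); lia.
Qed.

Lemma stage_potential_ge0 z k : unit_steps z -> `|z 0%N| < n%:Z ->
  0 <= stage_potential k z.
Proof.
move=> zu z0; case Ez: (stage z k) => [c|]; last by rewrite /stage_potential Ez.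
by apply: le_trans (stage_potential_ge zu z0 Ez); rewrite exprn_ge0.
Qed.

Lemma stage_potential0 z : `|z 0%N| < n%:Z -> stage_potential 0 z <= 2.
Proof.
move=> z0; rewrite /stage_potential /= expr0 mul1r /ruin.
rewrite ler_pdivrMr ?level_gt0 // -[2]/(2%:~R) -intrM ler_int.
by have := level_ge 0; case: (eps1 0) => ->; lia.
Qed.

(** The old affine expression dominates the new potential in all three cases: death replaces it by
    0, staying keeps it, and advancing lowers it. The affine expression averages exactly over the
    steps +1 and -1, which yields the supermartingale inequality. *)
Lemma stage_potential_step z y k c : unit_steps z -> `|z 0%N| < n%:Z ->
  unit_steps y -> (forall i, (i <= k)%N -> y i = z i) -> stage z k = Some c ->
  stage_potential k.+1 y <= (8 / 7) ^+ c * ruin c (y k.+1).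
Proof.
move=> zu z0 yu yz Ez; rewrite /stage_potential /= (eq_stage yz) Ez.
have yk := yu k; rewrite (yz k) // in yk.
have := stage_bounds zu z0 Ez (leqnn k); have := level_ge c => lc zk.
have y_ge : - (level c + n%:Z) <= eps c * y k.+1.
  by case: (eps1 c) zk yk => ->; lia.
case: ifP => dead.
  by rewrite mulr_ge0 ?exprn_ge0 // (le_trans ler01) ?ruin_ge1.
case: ifP => // up; rewrite exprSr -mulrA ler_pM2l ?exprn_gt0 //.
have y_eq : eps c * y k.+1 = level c - n%:Z.
  by case: (eps1 c) zk yk up => ->; lia.
have -> : ruin c (y k.+1) = 2.
  rewrite /ruin y_eq (_ : _ + n%:Z = 2 * (2 * level c)); last by lia.
  by rewrite intrM mulfK // gt_eqF // level_gt0.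
(* On advancing, the old factor equals 2 and the new one is at most 7/4, its value when both stages
   favour the same side; the multiplier 8/7 is exactly their ratio. *)
suff : ruin c.+1 (y k.+1) <= 7 / 4 by lra.
rewrite /ruin ler_pdivrMr ?level_gt0 // levelS.
have -> : 7 / 4 * (2 * (2 * level c))%:~R = (7 * level c)%:~R :> R.
  by rewrite !intrM; field.
rewrite ler_int; case: (eps1 c) (eps1 c.+1) y_eq => -> [] ->; lia.
Qed.

Lemma stage_potential_average z y1 y2 k : unit_steps z -> `|z 0%N| < n%:Z ->
  unit_steps y1 -> (forall i, (i <= k)%N -> y1 i = z i) ->
  unit_steps y2 -> (forall i, (i <= k)%N -> y2 i = z i) ->
  y1 k.+1 = z k + 1 -> y2 k.+1 = z k - 1 ->
  stage_potential k.+1 y1 + stage_potential k.+1 y2 <= 2 * stage_potential k z.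
Proof.
move=> zu z0 y1u y1z y2u y2z E1 E2; case Ez: (stage z k) => [c|]; last first.
  by rewrite /stage_potential /= !(eq_stage y1z, eq_stage y2z) Ez mulr0 addr0.
have h1 := stage_potential_step zu z0 y1u y1z Ez.
have h2 := stage_potential_step zu z0 y2u y2z Ez.
apply: le_trans (lerD h1 h2) _; rewrite E1 E2 [in leRHS]/stage_potential Ez.
rewrite -mulrDr mulrCA ler_pM2l ?exprn_gt0 // /ruin -mulrDl mulrA.
rewrite ler_pM2r ?invr_gt0 ?level_gt0 // -intrD -[2]/(2%:~R) -intrM ler_int.
by lia.
Qed.

Lemma stage_potential_unbounded z : unit_steps z -> `|z 0%N| < n%:Z ->
  (forall c, exists2 i, level c - n%:Z <= eps c * z i &
     forall j, (j <= i)%N -> - (level c + n%:Z) < eps c * z j) ->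
  forall lam : R, exists k, lam <= stage_potential k z.
Proof.
move=> zu z0 hits lam; pose m := Num.bound `|7 * lam|.
have [k [c [mc Ez]]] := stage_unbounded zu z0 hits m.
exists k; apply: le_trans (stage_potential_ge zu z0 Ez).
(* A weak form of Bernoulli's inequality, enough to make the powers unbounded; it explains the 7 in
   the choice of [m]. *)
have bernoulli : forall b : nat, b%:R / 7 <= (8 / 7) ^+ b :> R.
  elim=> [|b IH]; first by rewrite mul0r exprn_ge0.
  have : 1 <= (8 / 7) ^+ b :> R by apply: exprn_ege1; lra.
  by rewrite exprS -[b.+1%:R]natr1; lra.
apply: le_trans (bernoulli c); rewrite ler_pdivlMr // mulrC.
have : m%:R <= c%:R :> R by rewrite ler_nat.
by have := archi_boundP (normr_ge0 (7 * lam)); have := ler_norm (7 * lam); lra.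
Qed.

End stages.

(** * Integer paths confined to a bounded interval *)

Section confinement.
Variables (R : realType) (M : nat).

Definition confined (k : nat) (z : nat -> int) : bool :=
  [forall i : 'I_k.+1, `|z i| <= M%:Z].

(* With [M.+1] rather than [M] the unkilled expression is still nonnegative at
   the step leaving [-M, M], where the potential drops to 0. *)
Definition confinement_potential (k : nat) (z : nat -> int) : R :=
  if confined k z then ((M.+1 ^ 2)%:Z - z k ^+ 2 + k%:Z)%:~R else 0.

Lemma eq_confined z y k : (forall i, (i <= k)%N -> z i = y i) ->
  confined k z = confined k y.
Proof. by move=> zy; apply: eq_forallb => i; rewrite zy // -ltnS. Qed.

Lemma confinement_potential_ge z k : confined k z ->
  k%:R <= confinement_potential k z.
Proof.
rewrite /confinement_potential => h; rewrite h; move/forallP: h => /(_ ord_max) /=.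
by rewrite -[k%:R]/(k%:Z%:~R) ler_int; nia.
Qed.

Lemma confinement_potential_ge0 z k : 0 <= confinement_potential k z.
Proof.
case h: (confined k z); last by rewrite /confinement_potential h.
by apply: le_trans (confinement_potential_ge h).
Qed.

Lemma confinement_potential0 z : confinement_potential 0 z <= (M.+1 ^ 2)%N%:R.
Proof.
rewrite /confinement_potential; case: ifP => // _.
by rewrite -[leRHS]/((M.+1 ^ 2)%N%:Z%:~R) ler_int; nia.
Qed.

Lemma confinement_potential_step z y k : unit_steps y ->
  (forall i, (i <= k)%N -> y i = z i) -> confined k z ->
  confinement_potential k.+1 y <=
    ((M.+1 ^ 2)%:Z - y k.+1 ^+ 2 + k.+1%:Z)%:~R.
Proof.
move=> yu yz /forallP/(_ ord_max) /= zk.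
rewrite /confinement_potential; case: ifP => // _; rewrite ler0z.
by have := yu k; rewrite (yz k) //; nia.
Qed.

(** The squares of [z k + 1] and [z k - 1] sum to [2 * z k ^+ 2 + 2], and the time term compensates
    the 2 exactly; killing only decreases the left side. *)
Lemma confinement_potential_average z y1 y2 k :
  unit_steps y1 -> (forall i, (i <= k)%N -> y1 i = z i) ->
  unit_steps y2 -> (forall i, (i <= k)%N -> y2 i = z i) ->
  y1 k.+1 = z k + 1 -> y2 k.+1 = z k - 1 ->
  confinement_potential k.+1 y1 + confinement_potential k.+1 y2 <=
    2 * confinement_potential k z.
Proof.
move=> y1u y1z y2u y2z E1 E2; case zM: (confined k z); last first.
  have out y : (forall i, (i <= k)%N -> y i = z i) ->
      confinement_potential k.+1 y = 0.
    move=> yz; rewrite /confinement_potential ifF //; apply/negbTE.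
    move/negbT: zM => /forallPn[i zi]; apply/forallPn.
    by exists (widen_ord (leqnSn _) i); rewrite /= yz // -ltnS.
  by rewrite !out // addr0 mulr_ge0 // confinement_potential_ge0.
have h1 := confinement_potential_step y1u y1z zM.
have h2 := confinement_potential_step y2u y2z zM.
apply: le_trans (lerD h1 h2) _; rewrite E1 E2 [in leRHS]/confinement_potential zM.
by rewrite -intrD -[2]/(2%:~R) -intrM ler_int; lia.
Qed.

End confinement.

(** * Token positions under a schedule of moves *)

(** A discrete intermediate value property: the counter starts at 0 and grows by at most one per
    move. *)
Lemma advances_surj (m : nat -> bool) t i : (i <= advances m t)%N ->
  exists2 t', (t' <= t)%N & advances m t' = i.
Proof.
elim: t => [|t IH] in i *.
  by rewrite /advances big_ord0 leqn0 => /eqP ->; exists 0%N; rewrite ?big_ord0.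
have [/IH[t' t't <-] _|ti it] := leqP i (advances m t).
  by exists t' => //; exact: leqW.
exists t.+1 => //; apply/eqP; rewrite eqn_leq it andbT.
rewrite /advances big_ord_recr /= -/(advances m t); case: (m t); lia.
Qed.

Lemma advances_unbounded (m : nat -> bool) :
  (forall t, exists2 u, (t <= u)%N & m u) ->
  forall i, exists t, advances m t = i.
Proof.
move=> minf i; suff [t /advances_surj[t' _ <-]] : exists t, (i <= advances m t)%N.
  by exists t'.
elim: i => [|i [t it]]; first by exists 0%N.
have [u tu mu] := minf t; exists u.+1.
rewrite /advances big_ord_recr /= mu addn1 ltnS (leq_trans it) //.
by rewrite /advances -(subnKC tu) big_split_ord /= leq_addr.
Qed.

Lemma advances_le (m : nat -> bool) t u : (t <= u)%N ->
  (advances m t <= advances m u)%N.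
Proof. by move=> tu; rewrite /advances -(subnKC tu) big_split_ord leq_addr. Qed.

(** * The cycle, its covering by the integers, and lifts of walks *)

Section cycle.
Variables (V : finType) (e : rel V) (s : seq V).
Hypotheses (s_size : (3 <= size s)%N) (s_uniq : uniq s)
  (s_mem : forall v, v \in s)
  (eE : forall x y, e x y = (y == next s x) || (x == next s y)).

Let x0 : V.
Proof. by case: s s_size. Qed.

(** The covering map from the integers onto the cycle. *)
Definition cycle_vertex (z : int) : V := nth x0 s `|(z %% size s)%Z|.

Lemma cycle_vertexDn (z : int) : cycle_vertex (z + size s) = cycle_vertex z.
Proof. by rewrite /cycle_vertex modzDr. Qed.

Lemma cycle_vertex_index v : cycle_vertex (index v s) = v.
Proof.
by rewrite /cycle_vertex modz_nat /= modn_small ?index_mem // nth_index.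
Qed.

Lemma next_nth_mod i : (i < size s)%N ->
  next s (nth x0 s i) = nth x0 s (i.+1 %% size s).
Proof.
move=> i_lt; rewrite next_nth mem_nth //.
case: s s_uniq i_lt => // y p yp_uniq i_lt; rewrite index_uniq //=.
have [ip|] := ltnP i (size p).
  by rewrite modn_small // (set_nth_default x0).
move: i_lt; rewrite /= ltnS => ip pi; have -> : i = size p by lia.
by rewrite modnn nth_default.
Qed.

Lemma next_cycle_vertex (z : int) : next s (cycle_vertex z) = cycle_vertex (z + 1).
Proof.
have n0 : (size s : int) != 0 by lia.
have zn : (`|(z %% size s)%Z| < size s)%N.
  by have := ltz_pmod z (d := size s) ltac:(lia); have := modz_ge0 z n0; lia.
rewrite /cycle_vertex next_nth_mod //; congr nth.
have -> : ((z + 1) %% size s)%Z = (((z %% size s)%Z + 1) %% size s)%Z by rewrite modzDml.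
have := modz_ge0 z n0; case: (z %% size s)%Z => // m _.
by rewrite -PoszD modz_nat /= addn1.
Qed.

(** This is where length at least 3 enters: it makes the two neighbours of a vertex distinct, so the
    degree is 2 and the direction of a step is well defined. The cases are the possible positions of
    the wrap-around. *)
Lemma next_next_neq v : next s (next s v) != v.
Proof.
have iv : (index v s < size s)%N by rewrite index_mem.
have n0 : (0 < size s)%N by lia.
rewrite -[v](nth_index x0 (s_mem v)) !next_nth_mod ?ltn_mod // nth_uniq ?ltn_mod //.
have [lt2|ge2] := ltnP (index v s).+2 (size s).
  by rewrite !modn_small; lia.
have [lt1|ge1] := ltnP (index v s).+1 (size s).
  by rewrite (modn_small lt1) (_ : _.+2 = size s) ?modnn; lia.
have -> : (index v s).+1 = size s by lia.
by rewrite modnn modn_small; lia.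
Qed.

Lemma edge_prev x y : e x y = (y == next s x) || (y == prev s x).
Proof.
rewrite eE; congr (_ || _); apply/eqP/eqP => ->.
  by rewrite prev_next.
by rewrite next_prev.
Qed.

Lemma transition_sum (R : realType) x (F : V -> R) :
  \sum_v transition R e x v * F v = (F (next s x) + F (prev s x)) / 2.
Proof.
have np : next s x != prev s x.
  apply/eqP => np; have := next_next_neq (prev s x).
  by rewrite next_prev // -np eqxx.
have deg : degree e x = 2%N.
  rewrite /degree (eq_card (B := pred2 (next s x) (prev s x))) ?card2 ?np //.
  by move=> y; rewrite !inE edge_prev.
rewrite (bigD1 (next s x)) //= (bigD1 (prev s x)) /=; last by rewrite eq_sym.
rewrite big1 ?addr0; last first.
  move=> y /andP[yn yp].
  by rewrite /transition edge_prev (negbTE yn) (negbTE yp) mul0r.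
by rewrite /transition !edge_prev !eqxx orbT deg /=; lra.
Qed.

(** Any step other than [next] counts as -1, so even a sequence that is not a walk has a lift with
    unit steps. *)
Definition lift (h : nat -> V) (i : nat) : int :=
  (index (h 0%N) s : int) +
  \sum_(j < i) (if h j.+1 == next s (h j) then 1 else -1).

Lemma liftS h i :
  lift h i.+1 = lift h i + (if h i.+1 == next s (h i) then 1 else -1).
Proof. by rewrite /lift big_ord_recr /= addrA. Qed.

Lemma lift_unit_steps h : unit_steps (lift h).
Proof. by move=> i; rewrite liftS; case: ifP => _; [left|right]. Qed.

Lemma lift0 h : `|lift h 0| < size s.
Proof.
by rewrite /lift big_ord0 addr0 ger0_norm // ltz_nat index_mem.
Qed.

Lemma eq_lift h h' k : (forall i, (i <= k)%N -> h i = h' i) ->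
  forall i, (i <= k)%N -> lift h i = lift h' i.
Proof.
move=> hh' i ik; rewrite /lift hh' //; congr (_ + _).
by apply: eq_bigr => -[j /= ji] _; rewrite !hh' //; lia.
Qed.

Lemma cycle_vertex_lift h : walk e h -> forall i, cycle_vertex (lift h i) = h i.
Proof.
move=> hw; elim=> [|i IH].
  by rewrite /lift big_ord0 addr0 cycle_vertex_index.
rewrite liftS; have := hw i; rewrite eE; case: eqP => [-> _|_ /= /eqP hi].
  by rewrite -next_cycle_vertex IH.
apply: (can_inj (prev_next s_uniq)).
by rewrite next_cycle_vertex subrK IH.
Qed.

Lemma superharmonic_lift (R : realType) (w : nat -> (nat -> int) -> R) :
  (forall k z, unit_steps z -> `|z 0%N| < size s -> 0 <= w k z) ->
  (forall k z y, (forall i, (i <= k)%N -> z i = y i) -> w k z = w k y) ->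
  (forall z y1 y2 k, unit_steps z -> `|z 0%N| < size s ->
    unit_steps y1 -> (forall i, (i <= k)%N -> y1 i = z i) ->
    unit_steps y2 -> (forall i, (i <= k)%N -> y2 i = z i) ->
    y1 k.+1 = z k + 1 -> y2 k.+1 = z k - 1 ->
    w k.+1 y1 + w k.+1 y2 <= 2 * w k z) ->
  superharmonic e (fun k h => w k (lift h)).
Proof.
move=> w0 wad wavg; split.
- by move=> k h; apply: w0; [exact: lift_unit_steps|exact: lift0].
- by move=> k h h' hh'; apply: wad => i ik; exact: eq_lift hh' _ ik.
move=> k h _; rewrite transition_sum ler_pdivrMr // mulrC.
have upd v i : (i <= k)%N -> lift (update h k.+1 v) i = lift h i.
  by apply: eq_lift => j jk; rewrite /update ltn_eqF.
apply: wavg; rewrite ?liftS ?upd //; try exact: lift_unit_steps.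
- exact: lift0.
- exact: upd.
- exact: upd.
- by rewrite /update eqxx ltn_eqF // eqxx.
- rewrite /update eqxx ltn_eqF // ifF //; apply/negbTE/eqP => np.
  by have := next_next_neq (prev s (h k)); rewrite next_prev // -np eqxx.
Qed.

(** Both lifts start in [[0, size s)]. A move changes their difference by one, so to leave the open
    window it would have to equal [size s] or its negative, and then both tokens would stand on the
    same vertex. *)
Lemma lift_close (r q : nat -> V) (m : nat -> bool) : walk e r -> walk e q ->
  (forall t, r (advances m t) <> q (advances (fun i => ~~ m i) t)) ->
  forall t,
    `|lift r (advances m t) - lift q (advances (fun i => ~~ m i) t)| < size s.
Proof.
move=> rw qw avoid t; set a := advances m; set b := advances _.
have aS u : a u.+1 = (a u + m u)%N by rewrite /a /advances big_ord_recr.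
have bS u : b u.+1 = (b u + ~~ m u)%N by rewrite /b /advances big_ord_recr.
elim: t => [|t IH].
  rewrite /a /b /advances !big_ord0 /lift !big_ord0.
  have : (index (r 0%N) s < size s)%N by rewrite index_mem.
  have : (index (q 0%N) s < size s)%N by rewrite index_mem.
  by lia.
have nf : lift r (a t.+1) != lift q (b t.+1) + size s.
  apply/eqP => E; apply: (avoid t.+1); rewrite -/a -/b.
  by rewrite -(cycle_vertex_lift rw) E cycle_vertexDn cycle_vertex_lift.
have nb : lift q (b t.+1) != lift r (a t.+1) + size s.
  apply/eqP => E; apply: (avoid t.+1); rewrite -/a -/b.
  by rewrite -(cycle_vertex_lift qw) E cycle_vertexDn cycle_vertex_lift.
move: nf nb; rewrite aS bS; case: (m t) => /=; rewrite ?addn0 ?addn1.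
  by have := lift_unit_steps r (a t); lia.
by have := lift_unit_steps q (b t); lia.
Qed.

Lemma successful_confined (r q : nat -> V) (M : nat) : walk e r -> walk e q ->
  successful r q -> (forall j, `|lift q j| <= M) ->
  forall i, `|lift r i| <= (M + size s)%N.
Proof.
move=> rw qw [m [m1 _ avoid]] qM i.
have [t <-] := advances_unbounded m1 i.
have := lift_close rw qw avoid t; have := qM (advances (fun i => ~~ m i) t).
by lia.
Qed.

(** At the move when the token of [q] first arrives at index [j], the other token is within [size s]
    of it, hence far out on side [eps]. Before that move the token of [q] is inside [(-L, L)], so
    the other cannot have been far out on the opposite side. *)
Lemma successful_follows (r q : nat -> V) (L : nat) (eps : int) (j : nat) :
  walk e r -> walk e q -> successful r q -> eps = 1 \/ eps = -1 ->
  L%:Z <= eps * lift q j -> (forall i, (i < j)%N -> `|lift q i| < L) ->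
  exists2 i, L%:Z - (size s)%:Z <= eps * lift r i &
    forall i', (i' <= i)%N -> - (L%:Z + (size s)%:Z) < eps * lift r i'.
Proof.
move=> rw qw [m [_ m2 avoid]] eps1 hit before.
have close := lift_close rw qw avoid.
pose b := advances (fun i => ~~ m i).
have exb : exists t, b t == j.
  by have [t tj] := advances_unbounded m2 j; exists t; apply/eqP.
case: (ex_minnP exb) => t /eqP tj tmin.
exists (advances m t).
  have := close t; rewrite -/b tj.
  by case: eps1 hit => ->; lia.
move=> i' /advances_surj[u ut <-].
have := close u; rewrite -/(b u).
have [->|ub] := eqVneq u t.
  by rewrite tj; case: eps1 hit => ->; lia.
have : (b u < j)%N.
  rewrite ltn_neqAle -{2}tj advances_le // andbT.
  by apply/negP => /tmin; lia.
by move=> /before; case: eps1 => ->; lia.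
Qed.

End cycle.

(** * Nullity of success for bounded and for unbounded lifts of the fixed walk *)

Theorem theorem3p5 (R : realType) (V : finType) (e : rel V) (He : is_cycle e) :
  ~ exists s : nat -> V, evasive R e s.
Proof.
have [s [s3 s_uniq s_mem eE]] := He.
move=> [q [qw [d [T [P [X [Xw]]]]]]]; apply/negP; rewrite -leNgt.
have n0 : (0 < size s)%N by lia.
have [[M qM]|q_unb] := pselect (exists M : nat, forall j, `|lift s q j| <= M).
  apply: (null_of_unbounded Xw
    (W := fun k h => confinement_potential R (M + size s) k (lift s h))
    (C := ((M + size s).+1 ^ 2)%N%:R)).
  - apply: (superharmonic_lift s3 s_uniq s_mem eE).
    + by move=> k z _ _; exact: confinement_potential_ge0.
    + move=> k z y zy; rewrite /confinement_potential (eq_confined _ zy).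
      by rewrite zy.
    + by move=> z y1 y2 k _ _; exact: confinement_potential_average.
  - by move=> h; exact: confinement_potential0.
  (* While confined, the potential at time [k] is at least [k], so any time beyond [lam] serves. *)
  move=> w succ Xww lam; exists (Num.bound `|lam|).
  apply: le_trans (confinement_potential_ge _ _).
    exact: le_trans (ler_norm _) (ltW (archi_boundP (normr_ge0 _))).
  apply/forallP => i.
  exact: (successful_confined s3 s_uniq s_mem eE Xww qw succ qM).
have exit (L : nat) : exists eps : int, (eps = 1 \/ eps = -1) /\
    exists2 j, L%:Z <= eps * lift s q j &
      forall i, (i < j)%N -> `|lift s q i| < L.
  have exj : exists j, L%:Z <= `|lift s q j|.
    apply: contrapT => nj; apply: q_unb; exists L => j.
    by rewrite leNgt; apply/negP => Lj; apply: nj; exists j; exact: ltW.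
  case: (ex_minnP exj) => j Lj jmin.
  have before i : (i < j)%N -> `|lift s q i| < L.
    by move=> ij; rewrite ltNge; apply/negP => /jmin; lia.
  have [y0|y0] := leP 0 (lift s q j); [exists 1|exists (-1)].
    by split; [left|exists j => //; lia].
  by split; [right|exists j => //; lia].
(* The sides are chosen from the fixed walk [q] alone, so the stage potential does not depend on the
   random outcome except through the path it is evaluated on. *)
have [eps epsP] := choice (fun c => exit (2 ^ c * (2 * size s))%N).
have eps1 c : eps c = 1 \/ eps c = -1 by case: (epsP c).
apply: (null_of_unbounded Xw
  (W := fun k h => stage_potential R (size s) eps k (lift s h)) (C := 2)).
- apply: (superharmonic_lift s3 s_uniq s_mem eE).
  + by move=> k z; exact: (stage_potential_ge0 R n0 eps1).
  + move=> k z y zy; rewrite /stage_potential (eq_stage _ _ zy).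
    by case: stage => // c; rewrite zy.
  + by move=> z y1 y2 k; exact: (stage_potential_average R n0 eps1).
- by move=> h; exact: (stage_potential0 R n0 eps1 (lift0 s_mem h)).
move=> w succ Xww; apply: stage_potential_unbounded => //.
- exact: lift_unit_steps.
- exact: lift0.
move=> c; have [_ [j hit before]] := epsP c.
exact: (successful_follows s3 s_uniq s_mem eE Xww qw succ (eps1 c) hit before).
Qed.
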